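(* Let $M\subseteq\mathbb{Z}^q_{\geq0}$ be an affine monoid. (1) $M$ is seminormal if and only if there exists $m\in\mathbb{Z}_{>1}$ such that $\frac1mM\cap\mathbb{Z}M=M$. (2) $M$ is normal if and only if $\frac1mM\cap\mathbb{Z}M=M$ for every $m\in\mathbb{Z}_{>1}$.
   Context: An affine monoid $M\subseteq\mathbb{Z}^q_{\geq 0}$ ($q$ a positive integer) is a finitely generated submonoid of $\mathbb{Z}^q$ contained in $\mathbb{Z}^q_{\geq0}$. $\mathbb{Z}M$ is the group generated by $M$, $C(M)=\mathbb{R}_{\geq0}M$ is the cone generated by $M$, and $\frac1mM=\{\gamma/m:\gamma\in M\}$. $M$ is seminormal if whenever $\alpha\in\mathbb{Z}M$ satisfies $2\alpha\in M$ and $3\alpha\in M$, then $\alpha\in M$. $M$ is normal if $C(M)\cap\mathbb{Z}M=M$. *)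

(* Defs.v *)
From HB Require Import structures.
From mathcomp Require Import all_boot all_order all_algebra.
From mathcomp Require Import all_classical all_reals.
Set Implicit Arguments.
Unset Strict Implicit.
Unset Printing Implicit Defensive.
Import Order.TTheory GRing.Theory Num.Theory.
Local Open Scope classical_set_scope.
Local Open Scope ring_scope.

Definition submonoid (V : zmodType) (A : set V) : Prop :=
  GRing.nmod_closed [in A].

Definition subgroup (V : zmodType) (A : set V) : Prop :=
  GRing.zmod_closed [in A].

Definition affine_monoid (q : nat) (M : set 'rV[int]_q) : Prop :=
  [/\ submonoid M,
      exists2 S : set 'rV[int]_q, finite_set S & M = smallest (@submonoid _) S
    & forall a, M a -> forall j, 0 <= a ord0 j].

Definition group_gen (q : nat) (M : set 'rV[int]_q) : set 'rV[int]_q :=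
  smallest (@subgroup _) M.

Definition seminormal_monoid (q : nat) (M : set 'rV[int]_q) : Prop :=
  forall a, group_gen M a -> M (a *+ 2) -> M (a *+ 3) -> M a.

(* The inclusion of Z^q into R^q. Sets of integer vectors are compared with
   [C(M)] and [(1/m)M] through their images under it. *)
Definition toR (R : realType) (q : nat) (a : 'rV[int]_q) : 'rV[R]_q :=
  map_mx intr a.
Arguments toR R {q} a.

Definition cone (R : realType) (q : nat) (M : set 'rV[int]_q) :
    set 'rV[R]_q :=
  [set x | exists (n : nat) (c : 'I_n -> R) (g : 'I_n -> 'rV[int]_q),
    [/\ forall i, 0 <= c i, forall i, M (g i)
      & x = \sum_(i < n) c i *: toR R (g i)]].
Arguments cone R {q} M _.

Definition fraction (R : realType) (q : nat) (m : nat) (M : set 'rV[int]_q) :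
    set 'rV[R]_q :=
  [set m%:R^-1 *: toR R a | a in M].
Arguments fraction R {q} m M _.

Definition normal_monoid (R : realType) (q : nat) (M : set 'rV[int]_q) : Prop :=
  cone R M `&` (toR R @` group_gen M) = toR R @` M.
Arguments normal_monoid R {q} M.

(* Main.v *)
(** For [m > 0] the identity [(1/m)M `&` ZM = M] says that [M a] follows from
    [M (a *+ m)] for every [a] in [ZM].

    Part (1). The condition for one [m > 1] gives seminormality because [m] is
    of the form [2 n + 3 d]. Conversely, choose [N > 0] that kills the torsion
    of [Z^q / <T>] for every set [T] of generators, and put [m = N + 1]. If
    [m a = \sum_i c_i s_i] is in [M] and [T] is the support of [c], then [N a]
    lies in [<T>], hence so does [a = m a - N a]. As [m a] has positive
    coefficients on [T], [a + k m a] is in [M] for [k] large. So [M] contains two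
    consecutive multiples of [a], hence all large multiples, and seminormality
    brings the bound down to [a] itself.

    Part (2). A lattice point of the real cone is, after a Caratheodory
    reduction to linearly independent vectors, a combination with rational
    coefficients, so one of its positive multiples is in [M]. *)
Require Import Defs.
From HB Require Import structures.
From mathcomp Require Import all_boot all_order all_algebra.
From mathcomp Require Import all_classical all_reals.
From mathcomp Require Import zify.
Set Implicit Arguments.
Unset Strict Implicit.
Unset Printing Implicit Defensive.
Import Order.TTheory GRing.Theory Num.Theory.
Local Open Scope classical_set_scope.
Local Open Scope ring_scope.

(** * Submonoids, their generators and the set [(1/m)M] *)

Section Submonoid.
Variables (V : zmodType) (M : set V).
Hypothesis hM : submonoid M.

Lemma submonoid0 : M 0.
Proof. by case: hM; rewrite inE. Qed.

Lemma submonoidD x y : M x -> M y -> M (x + y).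
Proof. by move=> Mx My; apply/set_mem; case: hM => _; apply; rewrite inE. Qed.

Lemma submonoid_sum (I : finType) (f : I -> V) :
  (forall i, M (f i)) -> M (\sum_i f i).
Proof.
by move=> Mf; apply: big_ind => //; [exact: submonoid0|exact: submonoidD].
Qed.

Lemma submonoidMn x n : M x -> M (x *+ n).
Proof.
move=> Mx; elim: n => [|n IH]; first exact: submonoid0.
by rewrite mulrS; apply: submonoidD.
Qed.

End Submonoid.

Lemma group_genMn (q : nat) (M : set 'rV[int]_q) a n :
  group_gen M a -> group_gen M (a *+ n).
Proof.
move=> Ga B [[B0 BB] MB].
have Ba : a \in [in B] by rewrite inE; apply: Ga.
have BD x y : x \in [in B] -> y \in [in B] -> x + y \in [in B].
  by move=> Bx By; rewrite -[y]opprK; apply: (BB) => //; rewrite -sub0r; apply: BB.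
elim: n => [|n IH]; first by rewrite mulr0n; apply/set_mem.
by rewrite mulrS; apply/set_mem/BD => //; apply/mem_set.
Qed.

Lemma generated_combination (V : zmodType) (n : nat) (s : 'I_n -> V) x :
  smallest (@submonoid _) (range s) x ->
  exists c : 'I_n -> nat, x = \sum_i s i *+ c i.
Proof.
have: smallest (@submonoid V) (range s) `<=`
    [set y | exists c : 'I_n -> nat, y = \sum_i s i *+ c i].
  apply: smallest_sub; last first.
    move=> _ [i _ <-]; exists (fun j => (j == i : nat)).
    rewrite (bigD1 i) //= eqxx mulr1n big1 ?addr0 // => j /negPf ->.
    by rewrite mulr0n.
  split; rewrite ?inE.
    by exists (fun=> 0%N); rewrite big1.
  move=> y z /set_mem[c ->] /set_mem[d ->]; rewrite inE.
  exists (fun i => (c i + d i)%N); rewrite -big_split /=.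
  by apply: eq_bigr => i _; rewrite mulrnDr.
exact.
Qed.

Lemma map_intr_inj (R : numDomainType) (p q : nat) :
  injective (map_mx intr : 'M[int]_(p, q) -> 'M[R]_(p, q)).
Proof.
move=> a b /matrixP ab; apply/matrixP => i j.
by move: (ab i j); rewrite !mxE => /intr_inj.
Qed.

Lemma toRMn (R : realType) (q m : nat) (a : 'rV[int]_q) :
  toR R (a *+ m) = m%:R *: toR R a.
Proof. by rewrite /toR raddfMn /= scaler_nat. Qed.

Lemma fraction_eqP (R : realType) (q m : nat) (M : set 'rV[int]_q) :
  (0 < m)%N -> submonoid M ->
  (fraction R m M `&` (toR R @` group_gen M) = toR R @` M) <->
  (forall a, group_gen M a -> M (a *+ m) -> M a).
Proof.
move=> m0 hM.
have mR : m%:R != 0 :> R by rewrite pnatr_eq0 -lt0n.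
have fracE a : fraction R m M (toR R a) <-> M (a *+ m).
  split=> [[b Mb ba]|Ma]; last first.
    by exists (a *+ m) => //; rewrite toRMn scalerA mulVf ?scale1r.
  suff <- : b = a *+ m by [].
  by apply: (@map_intr_inj R); rewrite -!/(toR R _) toRMn -ba scalerA divff ?scale1r.
split=> [E a Ga Ma|H].
  have : (toR R @` M) (toR R a) by rewrite -E; split; [apply/fracE|exists a].
  by case=> b Mb /map_intr_inj <-.
apply/seteqP; split=> [x [fx [a Ga ax]]|x [a Ma <-]].
- by exists a => //; apply: H => //; apply/fracE; rewrite ax.
- split; first by apply/fracE; apply: submonoidMn.
  by exists a => //; apply: sub_gen_smallest.
Qed.

(** * Denominators and torsion *)

Lemma common_denominator (I : finType) (f : I -> rat) :
  exists2 N : nat, (0 < N)%N &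
    exists g : I -> int, forall i, N%:R * f i = (g i)%:~R.
Proof.
exists (\prod_i `|denq (f i)|)%N.
  by rewrite prodn_gt0 // => i; rewrite absz_gt0 denq_neq0.
exists (fun i => (\prod_(j | j != i) `|denq (f j)|)%N%:Z * numq (f i)).
move=> i; rewrite (bigD1 i) //= natrM mulrAC rmorphM /= mulrC.
congr (_ * _); rewrite -{2}[f i]divq_num_den.
rewrite pmulrn abszE gtr0_norm ?denq_gt0 // mulrC divfK //.
by rewrite intr_eq0 denq_neq0.
Qed.

(** [N] is a common denominator of the entries of the rational pseudo-inverse of [A]. A vector [a]
    in the rational row span equals [a *m pinvmx A *m A], and multiplying by [N] makes the
    coefficients integers. *)
Lemma row_span_torsion (p q : nat) (A : 'M[int]_(p, q)) :
  exists2 N : nat, (0 < N)%N &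
    forall (a : 'rV_q) (m : nat) (u : 'rV_p), (0 < m)%N ->
      a *+ m = u *m A -> exists v : 'rV_p, a *+ N = v *m A.
Proof.
pose AQ := map_mx (intr : int -> rat) A.
have [N N0 [g gE]] := common_denominator (fun ij => pinvmx AQ ij.1 ij.2).
exists N => // a m u m0 E.
exists (a *m \matrix_(i, j) g (i, j)).
pose aQ := map_mx (intr : int -> rat) a.
have aA : (aQ <= AQ)%MS.
  rewrite -(eqmx_scale aQ (_ : m%:R != 0)) ?pnatr_eq0 -?lt0n //.
  by rewrite scaler_nat -raddfMn E /= map_mxM submxMl.
apply: (@map_intr_inj rat); rewrite raddfMn /= !map_mxM -/aQ -/AQ -{1}(mulmxKpV aA).
rewrite -scaler_nat scalemxAl scalemxAr; congr (_ *m _ *m _).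
by apply/matrixP => i j; rewrite [LHS]mxE [RHS]mxE [in RHS]mxE; apply: gE (i, j).
Qed.

(** * Seminormality and multiples of a vector *)

Lemma seminormal_descent (q : nat) (M : set 'rV[int]_q) (a : 'rV_q) (k : nat) :
  submonoid M -> seminormal_monoid M -> group_gen M a ->
  M (a *+ k) -> M (a *+ k.+1) -> M a.
Proof.
move=> hM sM Ga Mk Mk1.
have [k0|k0] := posnP k; first by move: Mk1; rewrite k0.
have large n : (k * k <= n)%N -> M (a *+ n).
  move=> kn; have rk : (n %% k < k)%N by rewrite ltn_mod.
  have kd : (k <= n %/ k)%N by rewrite leq_divRL.
  (* The remainder is less than [k] and the quotient at least [k], so each unit of the remainder can
     turn one summand [k] into [k.+1]. *)
  have -> : n = (k.+1 * (n %% k) + k * (n %/ k - n %% k))%N.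
    by rewrite {1}(divn_eq n k); nia.
  by rewrite mulrnDr !mulrnA; apply: (submonoidD hM); apply: (submonoidMn hM).
(* If [a *+ n] is in [M] for all [n > K > 0], then so are [a *+ K *+ 2] and [a *+ K *+ 3]. *)
elim: (k * k)%N large => [|K IH] large; first exact: (large 1%N).
apply: IH => n; rewrite leq_eqVlt => /predU1P[<-{n}|/large//].
have [->|K0] := posnP K; first exact: (submonoid0 hM).
apply: sM; first exact: group_genMn.
  by rewrite -mulrnA; apply: large; lia.
by rewrite -mulrnA; apply: large; lia.
Qed.

Lemma seminormal_exponent (q n : nat) (M : set 'rV[int]_q)
    (s : 'I_n -> 'rV[int]_q) :
  submonoid M -> M = smallest (@submonoid _) (range s) -> seminormal_monoid M ->
  exists2 m : nat, (1 < m)%N &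
    forall a, group_gen M a -> M (a *+ m) -> M a.
Proof.
move=> hM Ms sM.
have Mgen i : M (s i) by rewrite Ms; apply: sub_gen_smallest; exists i.
(* Generators outside [T] become zero rows, so the row span is the group generated by [T] while the
   format stays the same for all [T]. *)
pose A (T : {set 'I_n}) := \matrix_i (if i \in T then s i else 0).
have /choice[N NA] (T : {set 'I_n}) : exists N : nat, (0 < N)%N /\
    forall (a : 'rV_q) (m : nat) (u : 'rV_n), (0 < m)%N ->
      a *+ m = u *m A T -> exists v : 'rV_n, a *+ N = v *m A T.
  by have [N N0 NA] := row_span_torsion (A T); exists N.
(* A multiple of every [N T], so that the exponent [P.+1] does not depend on [a]. *)
pose P := (\prod_(T : {set 'I_n}) N T)%N.
have P0 : (0 < P)%N by rewrite prodn_gt0 // => T; case: (NA T).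
exists P.+1 => // a Ga Ma.
have [c cE] : exists c : 'I_n -> nat, a *+ P.+1 = \sum_i s i *+ c i.
  by apply: generated_combination; rewrite -Ms.
pose T : {set 'I_n} := [set i | (0 < c i)%N]%SET.
pose u : 'rV[int]_n := \row_i (c i)%:Z.
have uE : a *+ P.+1 = u *m A T.
  rewrite cE mulmx_sum_row; apply: eq_bigr => i _.
  rewrite rowK !mxE inE -natz scaler_nat.
  by case: posnP => // ->; rewrite !mulr0n.
have [v vE] := (NA T).2 _ _ _ (ltn0Sn P) uE.
pose Q := (\prod_(T' | T' != T) N T')%N.
pose w := u - v *+ Q.
have wE : a = w *m A T.
  rewrite mulmxBl -uE mulrS -[v *+ Q]scaler_nat -scalemxAl -vE.
  by rewrite scaler_nat -mulrnA /P (bigD1 T) //= addrK.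
(* [K] bounds every [|w_i|], and [c i >= 1] on [T], so [w_i + K * c i] is nonnegative there and
   [absz] leaves it unchanged. *)
pose K := (\sum_i absz (w 0%R i))%N.
have aK : a + a *+ P.+1 *+ K =
    \sum_i s i *+ (if i \in T then absz (w 0 i + (K * c i)%:Z) else 0%N).
  rewrite {1}wE cE mulmx_sum_row -sumrMnl -big_split /=.
  apply: eq_bigr => i _; rewrite rowK inE; case: posnP => [->|ci].
    by rewrite scaler0 !mulr0n mul0rn addr0.
  have wK : (absz (w 0%R i) <= K)%N by rewrite /K (bigD1 i) //= leq_addr.
  rewrite -mulrnA -[s i *+ _ in RHS]scaler_nat natz -[s i *+ (_ * _)]scaler_nat natz.
  rewrite -scalerDl mulnC; congr (_ *: _).
  have : (K <= K * c i)%N by rewrite leq_pmulr.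
  by move: (w 0 i) (K * c i)%N wK => z d; lia.
apply: (@seminormal_descent _ _ _ (P.+1 * K)%N) => //.
  by rewrite mulrnA; apply: submonoidMn.
rewrite mulrS mulrnA aK; apply: submonoid_sum => // i.
exact: submonoidMn.
Qed.

(** * Lattice points of a real cone *)

Lemma real_cone_combination (R : realType) (q n : nat)
    (g : 'I_n -> 'rV[int]_q) (c : 'I_n -> R) (a : 'rV[int]_q) :
  (forall i, 0 <= c i) -> toR R a = \sum_i c i *: toR R (g i) ->
  exists2 k : nat, (0 < k)%N &
    exists u : 'I_n -> nat, a *+ k = \sum_i g i *+ u i.
Proof.
elim: n g c => [|n IH] g c c0 aE.
  exists 1%N => //; exists (fun=> 0%N); rewrite big_ord0.
  apply: (@map_intr_inj R); rewrite mulr1n -!/(toR R _) aE big_ord0.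
  by apply/matrixP => i j; rewrite !mxE.
pose G : 'M[rat]_(n.+1, q) := \matrix_i map_mx intr (g i).
pose aQ : 'rV[rat]_q := map_mx intr a.
have ratrE p r (B : 'M[int]_(p, r)) :
    map_mx (ratr : rat -> R) (map_mx intr B) = map_mx intr B.
  by apply/matrixP => i j; rewrite !mxE ratr_int.
have combE (b : 'I_n.+1 -> R) :
    \sum_i b i *: toR R (g i) = (\row_i b i) *m map_mx ratr G.
  rewrite mulmx_sum_row; apply: eq_bigr => i _.
  by rewrite mxE -map_row rowK ratrE.
(* If the [g i] are independent, the coefficients are unique. Membership in the span descends from
   the reals to the rationals, so the [c i] are rational. *)
have [Gfree|] := boolP (row_free G).
  have /submxP[w wE] : (aQ <= G)%MS.
    rewrite -(map_submx (ratr : {rmorphism rat -> R})) ratrE -/(toR R a) aE combE.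
    exact: submxMl.
  have wc i : c i = ratr (w ord0 i).
    have : map_mx ratr w = \row_i c i.
      apply: (@row_free_inj _ _ _ _ (map_mx (ratr : rat -> R) G)).
        by rewrite row_free_map.
      by rewrite -combE -aE -map_mxM -wE ratrE.
    by move/rowP/(_ i); rewrite !mxE.
  have [N N0 [h hE]] := common_denominator (fun i => w ord0 i).
  exists N => //; exists (fun i => `|h i|%N).
  have h0 i : 0 <= h i.
    rewrite -(ler0z rat) -hE mulr_ge0 ?ler0n //.
    by rewrite -(ler0q R) -wc.
  apply: (@map_intr_inj rat); rewrite raddfMn /= -/aQ wE mulmx_sum_row.
  rewrite raddf_sum -scaler_nat scaler_sumr; apply: eq_bigr => i _.
  rewrite rowK scalerA hE raddfMn -scaler_nat /=; congr (_ *: _).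
  by rewrite pmulrn gez0_abs.
rewrite -kermx_eq0 => /rowV0Pn[v0 /sub_kermxP v0G v0N].
have [v vG [i0 vi0]] : exists2 v : 'rV[rat]_n.+1, v *m G = 0 &
    exists i, 0 < v ord0 i.
  have /rV0Pn[i vi] := v0N.
  have [vi0|vi0|/eqP] := ltgtP (v0 ord0 i) 0; last by rewrite (negPf vi).
    exists (- v0); first by rewrite mulNmx v0G oppr0.
    by exists i; rewrite mxE oppr_gt0.
  by exists v0 => //; exists i.
(* The least ratio is the largest multiple of [v] that can be subtracted from [c] with all
   coefficients remaining nonnegative. *)
case: (@arg_minP _ R _ i0 (fun i => 0 < v ord0 i)
  (fun i => c i / ratr (v ord0 i)) vi0) => j vj jmin.
(* Moving along the relation [v] until the coefficient of index [j] vanishes. *)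
pose t := c j / ratr (v ord0 j).
pose c' i := c i - t * ratr (v ord0 i).
have t0 : 0 <= t by rewrite divr_ge0 // ler0q ltW.
have c'0 i : 0 <= c' i.
  rewrite subr_ge0; have [vi|vi] := ltP 0 (v ord0 i).
    by rewrite -ler_pdivlMr ?ltr0q //; apply: jmin.
  by apply: le_trans (c0 i); rewrite mulr_ge0_le0 // lerq0.
have c'j : c' j = 0 by rewrite /c' divfK ?subrr // fmorph_eq0 gt_eqF.
have c'E : toR R a = \sum_i c' i *: toR R (g i).
  rewrite combE (_ : (\row_i c' i) = (\row_i c i) - t *: map_mx ratr v).
    by rewrite mulmxBl -scalemxAl -map_mxM vG map_mx0 scaler0 subr0 -combE.
  by apply/rowP => i; rewrite !mxE.
move: c'E; rewrite (bigD1_ord j) //= c'j scale0r add0r => /IH[//|k k0 [u uE]].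
(* The dropped vector [g j] gets coefficient 0. *)
exists k => //; exists (fun i => oapp u 0%N (unlift j i)).
rewrite (bigD1_ord j) //= unlift_none mulr0n add0r uE.
by apply: eq_bigr => i _; rewrite liftK.
Qed.

Theorem proposition3p5 (R : realType) (q : nat) (hq : (0 < q)%N)
    (M : set 'rV[int]_q) (hM : affine_monoid M) :
  (seminormal_monoid M <->
     exists m : nat, (1 < m)%N /\
       fraction R m M `&` (toR R @` group_gen M) = toR R @` M) /\
  (normal_monoid R M <->
     forall m : nat, (1 < m)%N ->
       fraction R m M `&` (toR R @` group_gen M) = toR R @` M).
Proof.
case: hM => sub_M [S /finite_seqP[s ->] Ms] _.
have MG a : M a -> group_gen M a by exact: sub_gen_smallest.
have rs : [set` s] = range (tnth (in_tuple s)).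
  apply/seteqP; split=> [x /= xs|_ [i _ <-]]; last exact: mem_tnth.
  by have /tnthP[i ->] : x \in in_tuple s by []; exists i.
rewrite rs in Ms.
split; split=> [|].
- move=> /(seminormal_exponent sub_M Ms)[m m1 Hm].
  by exists m; split=> //; apply/fraction_eqP => //; apply: ltnW.
- case=> m [m1 /(fraction_eqP R (ltnW m1) sub_M) H] a Ga M2 M3.
  apply: H => //.
  (* An odd [m] is at least 3 and uses one 3; the truncated subtraction is then exact. *)
  have [n [d ->]] : exists n d, m = (2 * n + 3 * d)%N.
    by exists (m./2 - odd m)%N, (odd m : nat); lia.
  by rewrite mulrnDr !mulrnA; apply: submonoidD => //; apply: submonoidMn.
- move=> E m m1; apply/fraction_eqP => //; first exact: ltnW.
  move=> a Ga Ma.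
  have : (toR R @` M) (toR R a).
    rewrite -E; split; last by exists a.
    exists 1%N, (fun=> m%:R^-1), (fun=> a *+ m); split => //.
      by move=> _; rewrite invr_ge0.
    rewrite big_ord1 toRMn scalerA mulVf ?scale1r //.
    by rewrite pnatr_eq0 -lt0n ltnW.
  by case=> b Mb /map_intr_inj <-.
- move=> H; apply/seteqP; split=> [x [cx [a Ga aE]]|x [a Ma <-]]; last first.
    split; last by exists a => //; apply: MG.
    exists 1%N, (fun=> 1), (fun=> a); split => //.
    by rewrite big_ord1 scale1r.
  move: cx; rewrite -aE => -[n [c [g [c0 Mg /(real_cone_combination c0)]]]].
  case=> k k0 [u uE].
  (* [k] may be 1, so it is doubled to be an admissible exponent. *)
  have k1 : (1 < k * 2)%N by lia.
  exists a => //; move/(fraction_eqP R (ltnW k1) sub_M): (H _ k1); apply => //.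
  rewrite mulrnA uE; apply: submonoidMn => //; apply: submonoid_sum => // i.
  exact: submonoidMn.
Qed.
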